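(* Let $\mathcal{H}$ be a real Hilbert space, let $0<\sigma\le\beta<\infty$, let $f,g:\mathcal{H}\to\mathbb{R}\cup\{\infty\}$ be proper, closed and convex, and suppose that $f$ is $\sigma$-strongly convex and $\beta$-smooth. Let $\gamma\in(0,\infty)$, put $$\delta:=\max\left(\frac{\gamma\beta-1}{\gamma\beta+1},\frac{1-\gamma\sigma}{1+\gamma\sigma}\right),$$ and let $\alpha\in\left(0,\frac{2}{1+\delta}\right)$. Then the Douglas–Rachford iteration $$z^{k+1}=\big((1-\alpha)\mathrm{Id}+\alpha R_{\gamma g}R_{\gamma f}\big)z^k,\qquad k\ge 0,$$ started at any $z^0\in\mathcal{H}$, converges linearly towards a fixed point $\bar z$ of $R_{\gamma g}R_{\gamma f}$ at least with rate $|1-\alpha|+\alpha\delta$ (which is $<1$), i.e. for all $k\ge0$ $$\|z^{k+1}-\bar z\|\le\big(|1-\alpha|+\alpha\delta\big)\|z^k-\bar z\|.$$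
   Context: For a proper, closed, convex $h:\mathcal{H}\to\mathbb{R}\cup\{\infty\}$ and $\gamma>0$: the proximal operator is $\mathrm{prox}_{\gamma h}(z)=\operatorname{argmin}_x\{\gamma h(x)+\frac12\|x-z\|^2\}$, and the reflected proximal operator is $R_{\gamma h}=2\,\mathrm{prox}_{\gamma h}-\mathrm{Id}$. $f$ is $\sigma$-strongly convex if $f-\frac{\sigma}{2}\|\cdot\|^2$ is convex. $f$ is $\beta$-smooth if it is differentiable and $\frac{\beta}{2}\|\cdot\|^2-f$ is convex. *)

(* Defs.v *)
From HB Require Import structures.
From mathcomp Require Import all_boot all_order all_algebra.
From mathcomp Require Import all_classical all_reals all_analysis.
Set Implicit Arguments.
Unset Strict Implicit.
Unset Printing Implicit Defensive.
Import Order.TTheory GRing.Theory Num.Theory.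
Import numFieldNormedType.Exports.
Local Open Scope classical_set_scope.
Local Open Scope ring_scope.

Section convex_analysis.
Context {R : realType} {H : completeNormedModType R}.
Implicit Types (h : H -> \bar R) (gamma sigma beta : R) (x y z : H).

Definition proper_function h : Prop :=
  (forall x, h x != -oo%E) /\ exists x, h x != +oo%E.

Definition closed_function h : Prop :=
  closed [set p : H * R | (h p.1 <= p.2%:E)%E].

(* [convex_function] of the library is restricted to real-valued functions.
   Since [0 * +oo = 0] in [\bar R], the endpoints t = 0, 1 are harmless. *)
Definition convex_efunction h : Prop :=
  forall x y (t : R), 0 <= t <= 1 ->
    (h (t *: x + (1 - t) *: y)%R <= t%:E * h x + (1 - t)%:E * h y)%E.

Definition strongly_convex sigma h : Prop :=
  convex_efunction (fun x => h x - (sigma / 2 * `|x| ^+ 2)%:E)%E.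

(* An extended-real function is (Frechet) differentiable on the whole space
   when it is finite everywhere and differentiable as a real function. *)
Definition edifferentiable h : Prop :=
  (forall x, h x \is a fin_num) /\
  (forall x, differentiable (fun u => fine (h u)) x).

Definition smooth beta h : Prop :=
  edifferentiable h /\
  convex_efunction (fun x => (beta / 2 * `|x| ^+ 2)%:E - h x)%E.

Definition argmin h : set H := [set x | forall y, (h x <= h y)%E].

(* [prox gamma h z] selects an element of the argmin, which is a singleton when
   h is proper, closed and convex, gamma > 0, and H is a Hilbert space; [z] is
   only a default value for an empty argmin. *)
Definition prox gamma h z : H :=
  xget z (argmin (fun x => gamma%:E * h x + (2^-1 * `|x - z| ^+ 2)%:E)%E).

Definition reflected_prox gamma h z : H := 2 *: prox gamma h z - z.

End convex_analysis.

(* Main.v *)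
Require Import Defs.
From mathcomp Require Import all_boot all_order all_algebra.
From mathcomp Require Import all_classical all_reals all_analysis.
From mathcomp Require Import ring lra.
Set Implicit Arguments.
Unset Strict Implicit.
Unset Printing Implicit Defensive.
Import Order.TTheory GRing.Theory Num.Theory.
Import numFieldNormedType.Exports.
Local Open Scope classical_set_scope.
Local Open Scope ring_scope.

(** Write a point as [z = p + gamma *: u], where [p = prox gamma h z] and
    [u = gamma^-1 *: (z - p)]. Minimality of [p] makes [u] a subgradient of [h]
    at [p], and the reflection is [p - gamma *: u]. So for two points, with
    [d] and [e] the differences of the [p]s and of the [u]s, the reflected
    points differ by [r = d - gamma *: e], while the points themselves differ
    by [s = d + gamma *: e]; a Lipschitz bound for the reflection is a bound
    of [|r|] by [|s|].

    For a merely convex function the subgradients are monotone, [0 <= '[e, d]],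
    and this says exactly [|r| <= |s|]: the reflection of [g] is nonexpansive.
    For [f], strong convexity and smoothness confine [e] to the operator
    interval between [sigma *: d] and [beta *: d], in the sense that
    [0 <= '[e - sigma *: d, beta *: d - e]] ([interpolation_ge0]). Rewritten in
    terms of [s] and [r], this is [0 <= '[a *: s - r, b *: s + r]] where [a] and
    [b] are the two quotients in [delta], and Cauchy-Schwarz turns it into
    [|r| <= max a b * |s|] ([reflection_le]). Hence the composition of the two
    reflections is a [delta]-contraction with [delta < 1], it has a fixed point
    by Banach's theorem, and averaging with weight [alpha] gives the rate
    [|1 - alpha| + alpha * delta].

    Two points need care. The proximal point must exist
    ([prox_objective_has_min]): a convex function that is bounded below near a
    point of its domain decreases at most linearly far away, so that adding the
    quadratic term bounds the objective below, and strong convexity of the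
    objective then makes minimizing sequences Cauchy. And [u] is the slope not
    only of a lower but also of a quadratic upper bound for [f] at [p], as the
    gradient of [f] would be: the upper bound follows from the convexity of
    [beta / 2 |.|^2 - f] and the lower bound at [p] alone
    ([smooth_upper_bound]). *)

(** * Inner products and reflections *)

Section HilbertSpace.
Context {R : realType} {H : completeNormedModType R} (ip : {dot H for idfun}).
Hypothesis normH : forall x : H, `|x| ^+ 2 = ip x x.
Implicit Types (x y z p w u r s : H) (t gamma sigma beta : R) (h : H -> \bar R).

Local Notation "''[' u , v ]" := (ip u%R v%R) : ring_scope.

Lemma ipDl x y z : '[x + y, z] = '[x, z] + '[y, z].
Proof. exact: linearDl. Qed.
Lemma ipC x y : '[x, y] = '[y, x].
Proof. by rewrite (hermC ip) expr0 mul1r. Qed.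
Lemma ipZl t x y : '[t *: x, y] = t * '[x, y].
Proof. exact: linearZl_LR. Qed.
Lemma ipNl x y : '[- x, y] = - '[x, y].
Proof. exact: linearNl. Qed.
Lemma ipDr x y z : '[x, y + z] = '[x, y] + '[x, z].
Proof. by rewrite ipC ipDl !(ipC x). Qed.
Lemma ipZr t x y : '[x, t *: y] = t * '[x, y].
Proof. by rewrite ipC ipZl ipC. Qed.
Lemma ipNr x y : '[x, - y] = - '[x, y].
Proof. by rewrite ipC ipNl ipC. Qed.
Definition ipE := (normH, ipDl, ipDr, ipNl, ipNr, ipZl, ipZr).

(** In an inner product space this is the triangle inequality, squared. *)
Lemma cauchy_schwarz x y : '[x, y] <= `|x| * `|y|.
Proof.
have : `|x + y| ^+ 2 <= (`|x| + `|y|) ^+ 2.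
  by rewrite ler_pXn2r ?nnegrE ?addr_ge0// ler_normD.
rewrite sqrrD !normH !ipDl !ipDr (ipC y x); lra.
Qed.

(** By Cauchy-Schwarz, if [a] is the larger coefficient, the hypothesis bounds
    [(|r| - a |s|) (|r| + b |s|)] by 0, and [|r| > a |s|] would make both
    factors positive since [0 <= a + b]; the other case is symmetric. *)
Lemma reflection_le a b s r : 0 <= a + b ->
  0 <= '[a *: s - r, b *: s + r] -> `|r| <= Num.max a b * `|s|.
Proof.
move=> ab_ge0; rewrite !ipE (ipC r s) -!normH => h.
have cs1 := cauchy_schwarz s r.
have cs2 : - '[s, r] <= `|s| * `|r| by rewrite -ipNl -(normrN s) cauchy_schwarz.
set S := `|s| in h cs1 cs2 *; set N := `|r| in h cs1 cs2 *.
have S_ge0 : 0 <= S by rewrite normr_ge0.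
have N_ge0 : 0 <= N by rewrite normr_ge0.
have abS : 0 <= (a + b) * S by rewrite mulr_ge0.
rewrite leNgt; apply/negP.
have [ab|ba] := leP a b => [N_gt|N_gt].
- have : 0 < (N - b * S) * (N + a * S) by rewrite mulr_gt0//; lra.
  have : (b - a) * - '[s, r] <= (b - a) * (S * N)
    by rewrite ler_wpM2l ?subr_ge0.
  nra.
- have : 0 < (N - a * S) * (N + b * S) by rewrite mulr_gt0//; lra.
  have : (a - b) * '[s, r] <= (a - b) * (S * N)
    by rewrite ler_wpM2l// subr_ge0 ltW.
  nra.
Qed.

(** * Existence of the proximal point *)

Lemma convex_strongly_convex0 h : convex_efunction h -> strongly_convex 0 h.
Proof.
by move=> hc x y t t01; rewrite !mul0r !sube0; exact: hc.
Qed.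

Lemma normsq_convex_comb t x y :
  `|t *: x + (1 - t) *: y| ^+ 2 =
  t * `|x| ^+ 2 + (1 - t) * `|y| ^+ 2 - t * (1 - t) * `|x - y| ^+ 2.
Proof. rewrite !ipE (ipC y x); ring. Qed.

(** The extended-real definition, transferred to real numbers at two points of
    the domain; the quadratic term accounts for the curvature of the square of
    the norm ([normsq_convex_comb]). *)
Lemma strongly_convex_comb sigma h x y a b t :
  proper_function h -> strongly_convex sigma h ->
  h x = a%:E -> h y = b%:E -> 0 <= t <= 1 ->
  exists2 c, h (t *: x + (1 - t) *: y) = c%:E
    & c <= t * a + (1 - t) * b - sigma / 2 * (t * (1 - t) * `|x - y| ^+ 2).
Proof.
move=> [hNy _] hc hx hy t01; have := hc x y t t01; rewrite hx hy.
case: (h (t *: x + (1 - t) *: y)) (hNy (t *: x + (1 - t) *: y)) => // c _.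
rewrite -!EFinB -!EFinM -EFinD lee_fin normsq_convex_comb => le_c.
by exists c => //; lra.
Qed.

(** As the epigraph is closed and misses [(x0, a0 - 1)], [h] exceeds [a0 - 1] on
    a ball of radius [e] around [x0]. If [h] were too small at a point outside
    the ball, then by convexity it would be at most [a0 - 1] at the point of
    the segment to [x0] at distance [e / 2] from [x0]. The quadratic
    term of the proximal objective absorbs a decrease that is linear in the
    distance ([prox_objective_lbound]). *)
Lemma convex_norm_minorant h x0 a0 :
  proper_function h -> closed_function h -> convex_efunction h ->
  h x0 = a0%:E ->
  exists2 K, 0 <= K & forall x a, h x = a%:E -> a0 - 1 - K * `|x - x0| <= a.
Proof.
move=> hp hcl hc hx0.
have : nbhs (x0, a0 - 1) (~` [set p : H * R | (h p.1 <= p.2%:E)%E]).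
  apply: open_nbhs_nbhs; split; first exact: closed_openC.
  by rewrite /= hx0 lee_fin; apply/negP; rewrite -ltNge; lra.
rewrite -nbhs_ballE => -[e /= e_gt0 ball_h].
have near_ge x a : `|x - x0| < e -> h x = a%:E -> a0 - 1 < a.
  move=> xe hx; have /= := ball_h (x, a0 - 1); rewrite hx lee_fin.
  move/(_ _)/negP; rewrite -ltNge; apply; split => /=.
    by rewrite -ball_normE /= distrC.
  exact: ballxx.
exists (2 / e); first by rewrite divr_ge0 ?ltW.
move=> x a hx; have [xe|xe] := ltP `|x - x0| e.
  have := near_ge x a xe hx.
  have : 0 <= 2 / e * `|x - x0| by rewrite mulr_ge0// divr_ge0// ltW.
  lra.
set d := `|x - x0| in xe *; have d_gt0 : 0 < d by rewrite (lt_le_trans e_gt0).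
pose t := e / (2 * d).
have t_gt0 : 0 < t by rewrite divr_gt0// mulr_gt0.
have t01 : 0 <= t <= 1 by rewrite ltW//= ler_pdivrMr ?mulr_gt0//; lra.
have [c hct lec] :=
  strongly_convex_comb hp (convex_strongly_convex0 hc) hx hx0 t01.
have : a0 - 1 < c.
  apply: near_ge hct.
  have -> : t *: x + (1 - t) *: x0 - x0 = t *: (x - x0).
    by rewrite scalerBl scale1r scalerBr addrA addrAC addrK.
  rewrite normrZ gtr0_norm// -/d /t.
  rewrite (_ : e / (2 * d) * d = e / 2) ?gtr_pMr ?invf_lt1 ?ltr1n//.
  by field; rewrite gt_eqF.
rewrite mul0r mul0r subr0 in lec => lt_c.
have : - 1 < t * (a - a0) by lra.
rewrite -ltr_pdivrMl// mulrN1 (_ : t^-1 = 2 / e * d); first by lra.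
by rewrite /t; field; rewrite !gt_eqF.
Qed.

Lemma prox_objective_lbound h gamma z : 0 < gamma ->
  proper_function h -> closed_function h -> convex_efunction h ->
  exists m, forall x a, h x = a%:E -> m <= gamma * a + 2^-1 * `|x - z| ^+ 2.
Proof.
move=> g0 hp hcl hc.
have [x0 [a0 hx0]] : exists x0 a0, h x0 = a0%:E.
  have [hNy [x0 hx0]] := hp; exists x0.
  by case: (h x0) (hNy x0) hx0 => // a _ _; exists a.
have [K K_ge0 hK] := convex_norm_minorant hp hcl hc hx0.
(* The subtracted square is the loss in minimizing s^2 / 2 - gamma K s. *)
exists (gamma * (a0 - 1 - K * `|z - x0|) - 2^-1 * (gamma * K) ^+ 2) => x a hx.
have : gamma * (a0 - 1 - K * `|x - x0|) <= gamma * a by rewrite ler_pM2l// hK.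
have : gamma * K * `|x - x0| <= gamma * K * (`|x - z| + `|z - x0|).
  by rewrite ler_wpM2l ?mulr_ge0 ?ler_distD// ltW.
have := sqr_ge0 (`|x - z| - gamma * K); nra.
Qed.

(** A minimizing sequence is Cauchy, because the objective at a midpoint lies
    below the average of its end values by [|x - y|^2 / 8] and is still at least
    the infimum. The limit attains the infimum by closedness of the epigraph. *)
Lemma prox_objective_has_min h gamma z : 0 < gamma ->
  proper_function h -> closed_function h -> convex_efunction h ->
  exists p a, h p = a%:E /\
    forall x b, h x = b%:E ->
      gamma * a + 2^-1 * `|p - z| ^+ 2 <= gamma * b + 2^-1 * `|x - z| ^+ 2.
Proof.
move=> g0 hp hcl hc.
pose S : set R := [set r | exists x a,
  h x = a%:E /\ r = gamma * a + 2^-1 * `|x - z| ^+ 2].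
have S_inf : has_inf S.
  split.
    have [hNy [x0 hx0]] := hp.
    exists (gamma * fine (h x0) + 2^-1 * `|x0 - z| ^+ 2).
    exists x0, (fine (h x0)); split=> //.
    by case: (h x0) (hNy x0) hx0.
  have [m hm] := prox_objective_lbound z g0 hp hcl hc.
  by exists m => _ [x [a [hx ->]]]; exact: hm hx.
pose m := inf S.
have m_le x a : h x = a%:E -> m <= gamma * a + 2^-1 * `|x - z| ^+ 2.
  by move=> hx; apply: (ge_inf S_inf.2); exists x, a.
have : forall n, exists q : H * R, h q.1 = q.2%:E /\
    gamma * q.2 + 2^-1 * `|q.1 - z| ^+ 2 < m + harmonic n.
  move=> n.
  have [_ [x [a [hx ->]]] lt_m] := inf_adherent (@harmonic_gt0 R n) S_inf.
  by exists (x, a).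
move=> /choice[q qP].
pose x n := (q n).1; pose a n := (q n).2.
have hx n : h (x n) = (a n)%:E := (qP n).1.
have lt_m n : gamma * a n + 2^-1 * `|x n - z| ^+ 2 < m + harmonic n := (qP n).2.
have x_dist i j : `|x i - x j| ^+ 2 <= 4 * (harmonic i + harmonic j).
  have h01 : 0 <= (2^-1 : R) <= 1 by lra.
  have [c hmid] := strongly_convex_comb hp (convex_strongly_convex0 hc)
    (hx i) (hx j) h01.
  have := m_le _ _ hmid.
  have -> : 2^-1 *: x i + (1 - 2^-1) *: x j - z =
      2^-1 *: (x i - z) + (1 - 2^-1) *: (x j - z).
    by rewrite !scalerBr addrACA -opprD -scalerDl subrKC scale1r.
  rewrite normsq_convex_comb (_ : x i - z - (x j - z) = x i - x j); last first.
    by rewrite opprB addrA subrK.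
  have := lt_m i; have := lt_m j; nra.
have x_cvg : cvg (x @ \oo).
  apply/cauchy_cvgP/cauchy_exP => e e_gt0.
  have [N _ hN] : \forall n \near \oo, harmonic n < e ^+ 2 / 8.
    have e8_gt0 : 0 < e ^+ 2 / 8 by rewrite divr_gt0// exprn_gt0.
    have /cvgr0_norm_lt/(_ _ e8_gt0) := @cvg_harmonic R.
    by apply: filterS => n; rewrite ger0_norm// harmonic_ge0.
  exists (x N); exists N => // n /= Nn; rewrite -ball_normE /=.
  have hNN : harmonic N < e ^+ 2 / 8 := hN N (leqnn N).
  have hNn : harmonic n < e ^+ 2 / 8 := hN n Nn.
  have : `|x N - x n| ^+ 2 < e ^+ 2 by apply: le_lt_trans (x_dist _ _) _; lra.
  by rewrite ltr_pXn2r ?nnegrE// ltW.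
pose p := lim (x @ \oo).
have px : x @ \oo --> p := x_cvg.
(* The bound on h (x n) given by lt_m, so that (x n, c n) is in the epigraph. *)
pose c n := gamma^-1 * (m + harmonic n - 2^-1 * `|x n - z| ^+ 2).
have c_cvg : c @ \oo --> gamma^-1 * (m + 0 - 2^-1 * `|p - z| ^+ 2).
  have xz : `|x n - z| @[n --> \oo] --> `|p - z|.
    by apply: cvg_norm; apply: cvgB => //; exact: cvg_cst.
  rewrite !expr2; apply: cvgM; first exact: cvg_cst.
  apply: cvgB; first by apply: cvgD; [exact: cvg_cst|exact: cvg_harmonic].
  by apply: cvgM; [exact: cvg_cst|exact: cvgM].
pose l := gamma^-1 * (m + 0 - 2^-1 * `|p - z| ^+ 2).
have xc_cvg : (x n, c n) @[n --> \oo] --> ((p, l) : H * R).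
  exact: (cvg_pair px c_cvg).
have epi_xc : \forall n \near \oo, (h (x n) <= (c n)%:E)%E.
  apply: nearW => n /=; rewrite hx lee_fin /c ler_pdivlMl//.
  by rewrite lerBrDr ltW.
have : (h p <= l%:E)%E.
  exact: (@closed_cvg _ _ _ _ (fun n => (x n, c n)) _ hcl epi_xc _ xc_cvg).
rewrite /l.
case hp_eq : (h p) (hp.1 p) => [b| |]// _;
  rewrite lee_fin ler_pdivlMl// addr0 => b_le.
exists p, b; split=> // w d /m_le; lra.
Qed.

(** * First-order bounds at the proximal point *)

Lemma ler_of_perturb (a b c : R) :
  (forall t, 0 < t < 1 -> a <= b + t * c) -> a <= b.
Proof.
move=> abc; rewrite leNgt; apply/negP => ba.
have c_gt0 : 0 < c.
  have := abc 2^-1; rewrite invr_gt0 ltr0n invf_lt1 ?ltr0n// ltr1n => /(_ isT).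
  lra.
(* The denominator makes t < 1 and t * c < a - b at the same time. *)
pose t := (a - b) / (2 * c + (a - b)).
have d_gt0 : 0 < 2 * c + (a - b) by lra.
have t01 : 0 < t < 1.
  by rewrite /t divr_gt0 ?subr_gt0//= ltr_pdivrMr// mul1r; lra.
have := abc t t01; rewrite -lerBlDl => h.
have : (a - b) * (2 * c + (a - b)) <= (a - b) * c.
  by rewrite -ler_pdivlMr// mulrAC.
by rewrite ler_pM2l ?subr_gt0//; lra.
Qed.

(** For convex [h], a subgradient of [h] at [prox gamma h z]
    ([prox_variational]). *)
Definition prox_residual gamma h z := gamma^-1 *: (z - prox gamma h z).

Lemma proxP h gamma z : 0 < gamma ->
  proper_function h -> closed_function h -> convex_efunction h ->
  exists2 a, h (prox gamma h z) = a%:E & forall w b, h w = b%:E ->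
    gamma * a + 2^-1 * `|prox gamma h z - z| ^+ 2 <=
    gamma * b + 2^-1 * `|w - z| ^+ 2.
Proof.
move=> g0 hp hcl hc.
have [p [a [hpa p_min]]] := prox_objective_has_min z g0 hp hcl hc.
have prox_min : argmin (fun x => gamma%:E * h x + (2^-1 * `|x - z| ^+ 2)%:E)%E
    (prox gamma h z).
  apply: xgetPex; exists p => y; rewrite hpa.
  case hy : (h y) (hp.1 y) => [b| |]// _.
    by rewrite -!EFinM -!EFinD lee_fin p_min.
  by rewrite gt0_muley ?lte_fin// addye// leey.
set q := prox gamma h z in prox_min *.
have [a' ha'] : exists a', h q = a'%:E.
  case hq : (h q) (hp.1 q) (prox_min p) => [b| |]// _; first by exists b.
  by rewrite hpa gt0_muley ?lte_fin// addye// -EFinM -EFinD.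
exists a' => // w b hw; have := prox_min w.
by rewrite ha' hw -!EFinM -!EFinD lee_fin.
Qed.

(** Compare the objective at the minimizer [p] with its value at
    [t *: w + (1 - t) *: p], divide by [t] and let [t] tend to 0. *)
Lemma prox_variational sigma h gamma z : 0 < gamma ->
  proper_function h -> closed_function h -> convex_efunction h ->
  strongly_convex sigma h ->
  exists2 a, h (prox gamma h z) = a%:E & forall w b, h w = b%:E ->
    a + '[prox_residual gamma h z, w - prox gamma h z]
      + sigma / 2 * `|w - prox gamma h z| ^+ 2 <= b.
Proof.
move=> g0 hp hcl hc hs; have [a ha p_min] := proxP z g0 hp hcl hc.
exists a => // w b hw; rewrite /prox_residual.
set p := prox gamma h z in ha p_min *.
rewrite -(ler_pM2l g0).
apply: (@ler_of_perturb _ _ (gamma * sigma / 2 * `|w - p| ^+ 2 +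
  2^-1 * `|w - p| ^+ 2)).
move=> t /andP[t0 t1].
have t01 : 0 <= t <= 1 by rewrite !ltW.
have [c hct lec] := strongly_convex_comb hp hs hw ha t01.
have := p_min _ _ hct.
have -> : t *: w + (1 - t) *: p - z = t *: (w - p) + (p - z).
  by rewrite scalerBl scale1r scalerBr !addrA (addrAC _ p).
have -> : `|t *: (w - p) + (p - z)| ^+ 2 =
    t ^+ 2 * `|w - p| ^+ 2 - 2 * t * '[z - p, w - p] + `|p - z| ^+ 2.
  rewrite -(opprB p z) [in RHS]ipNl.
  rewrite !(normH, ipDl (_ *: _), ipDr _ (_ *: _), ipZl, ipZr).
  rewrite (ipC (p - z) (w - p)); ring.
have : gamma * c <= gamma * (t * b + (1 - t) * a -
    sigma / 2 * (t * (1 - t) * `|w - p| ^+ 2)) by rewrite ler_pM2l.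
move=> lec' le_min; rewrite ipZl.
have -> : gamma * (a + gamma^-1 * '[z - p, w - p] + sigma / 2 * `|w - p| ^+ 2) =
    gamma * a + '[z - p, w - p] + gamma * (sigma / 2 * `|w - p| ^+ 2).
  by field; rewrite gt_eqF.
rewrite -(ler_pM2l t0); lra.
Qed.

Lemma smooth_comb beta h x y a b c t :
  smooth beta h -> h x = a%:E -> h y = b%:E ->
  h (t *: x + (1 - t) *: y) = c%:E -> 0 <= t <= 1 ->
  t * a + (1 - t) * b - beta / 2 * (t * (1 - t) * `|x - y| ^+ 2) <= c.
Proof.
move=> [_ hc] hx hy ht t01; have := hc x y t t01; rewrite hx hy ht.
rewrite -!EFinB -!EFinM -EFinD lee_fin normsq_convex_comb; lra.
Qed.

(** Since [p] lies between [w] and [q = p - t *: (w - p)], the value of [h] at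
    [w] is bounded above by those at [p] and [q], up to the curvature [beta];
    the value at [q] is bounded below by the subgradient [u]. Letting [t] tend
    to 0 shows that [u] is also the slope of an upper bound. *)
Lemma smooth_upper_bound beta h p u a : smooth beta h ->
  h p = a%:E -> (forall w b, h w = b%:E -> a + '[u, w - p] <= b) ->
  forall w b, h w = b%:E -> b <= a + '[u, w - p] + beta / 2 * `|w - p| ^+ 2.
Proof.
move=> hs hp lo w b hw.
apply: (@ler_of_perturb _ _ (beta / 2 * `|w - p| ^+ 2)) => t /andP[t0 t1].
pose q := p - t *: (w - p).
have hq : h q = (fine (h q))%:E by rewrite fineK// hs.1.1.
have loq := lo _ _ hq.
pose l := t / (1 + t).
have t1_gt0 : 0 < 1 + t by lra.
have l01 : 0 <= l <= 1.
  by apply/andP; rewrite /l ler_pdivrMr//; split; [apply: divr_ge0; lra|lra].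
have pE : p = l *: w + (1 - l) *: q.
  have -> : 1 - l = (1 + t)^-1 by rewrite /l; field; rewrite gt_eqF.
  apply: (@scalerI _ _ (1 + t)); first by rewrite gt_eqF.
  rewrite scalerDr !scalerA /l mulrC divfK ?gt_eqF// divff ?gt_eqF// scale1r.
  by rewrite /q scalerBr opprB addrCA subrKC scalerDl scale1r.
have wq : w - q = (1 + t) *: (w - p).
  by rewrite /q opprB addrCA addrC scalerDl scale1r.
have := smooth_comb hs hw hq (etrans (congr1 h (esym pE)) hp) l01.
rewrite wq normrZ exprMn (gtr0_norm t1_gt0) => up.
have : (1 + t) * (l * b + (1 - l) * fine (h q) -
  beta / 2 * (l * (1 - l) * ((1 + t) ^+ 2 * `|w - p| ^+ 2))) <= (1 + t) * a.
  by rewrite ler_pM2l.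
have -> : (1 + t) * (l * b + (1 - l) * fine (h q) -
  beta / 2 * (l * (1 - l) * ((1 + t) ^+ 2 * `|w - p| ^+ 2))) =
  t * b + fine (h q) - beta / 2 * (t * (1 + t) * `|w - p| ^+ 2).
  by rewrite /l; field; rewrite gt_eqF.
move: loq; rewrite /q [p - _ - p]addrAC subrr sub0r ipNr ipZr => loq le_a.
rewrite -(ler_pM2l t0); lra.
Qed.

(** The Baillon-Haddad argument for [F - sigma / 2 |.|^2], whose slopes
    at [p1] and [p2] differ by [G]. Compare the lower bound at one point with
    the upper bound at the other, at the points displaced by [t *: G]; the
    optimal displacement is [t = 1 / (beta - sigma)], and if [sigma = beta] then
    letting [t] grow forces [G = 0]. *)
Lemma interpolation_ge0 sigma beta (F : H -> R) p1 p2 u1 u2 : sigma <= beta ->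
  (forall w, F p1 + '[u1, w - p1] + sigma / 2 * `|w - p1| ^+ 2 <= F w) ->
  (forall w, F p2 + '[u2, w - p2] + sigma / 2 * `|w - p2| ^+ 2 <= F w) ->
  (forall w, F w <= F p1 + '[u1, w - p1] + beta / 2 * `|w - p1| ^+ 2) ->
  (forall w, F w <= F p2 + '[u2, w - p2] + beta / 2 * `|w - p2| ^+ 2) ->
  0 <= '[(u1 - u2) - sigma *: (p1 - p2), beta *: (p1 - p2) - (u1 - u2)].
Proof.
move=> sb lo1 lo2 up1 up2.
(* Both differences are made opaque, lest bilinearity expand them further. *)
have [d dE] : exists d, p1 - p2 = d by eexists.
have [G GE] : exists G, u1 - u2 - sigma *: d = G by eexists.
have u1E x : '[u1, x] = '[u2, x] + '[G, x] + sigma * '[d, x].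
  by rewrite -GE !ipE; ring.
have key t : 2 * t * '[G, G] - (beta - sigma) * t ^+ 2 * '[G, G] <= '[G, d].
  have := le_trans (lo1 (p2 + t *: G)) (up2 _).
  have := le_trans (lo2 (p1 - t *: G)) (up1 _).
  have -> : p2 + t *: G - p2 = t *: G by rewrite addrAC subrr add0r.
  have -> : p1 - t *: G - p1 = - (t *: G) by rewrite addrAC subrr add0r.
  have -> : p2 + t *: G - p1 = t *: G - d.
    by rewrite -dE opprB addrAC [RHS]addrC.
  have -> : p1 - t *: G - p2 = d - t *: G by rewrite -dE addrAC.
  rewrite !u1E !ipE (ipC d G); lra.
have -> : beta *: (p1 - p2) - (u1 - u2) = (beta - sigma) *: d - G.
  by rewrite -GE dE scalerBl [in RHS]opprB [RHS]addrA subrK.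
rewrite dE GE !ipE subr_ge0.
have G_ge0 : 0 <= '[G, G] by rewrite -normH exprn_ge0.
have [L_gt0|L_le0] := ltP 0 (beta - sigma); last first.
- have L0 : beta - sigma = 0 by lra.
  rewrite L0 mul0r leNgt; apply/negP => G_gt0.
  (* For this t the left-hand side of key exceeds '[G, d]. *)
  have := key ((`|'[G, d]| + 1) / '[G, G]).
  rewrite L0 !mul0r subr0 mulrA divfK ?gt_eqF//.
  have := ler_norm '[G, d]; have := normr_ge0 '[G, d]; move=> ? ? ?; lra.
- have := key (beta - sigma)^-1; rewrite -(ler_pM2l L_gt0).
  suff -> : (beta - sigma) * (2 * (beta - sigma)^-1 * '[G, G] -
    (beta - sigma) * (beta - sigma)^-1 ^+ 2 * '[G, G]) = '[G, G] by [].
  by field; rewrite gt_eqF.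
Qed.

(** * Lipschitz bounds for the reflected proximal operator *)

(** Here [d + gamma *: e] is the difference of the arguments and
    [d - gamma *: e] that of the reflected points. *)
Lemma reflected_prox_lipschitz a b gamma h z1 z2 : 0 < gamma -> 0 <= a + b ->
  let d := prox gamma h z1 - prox gamma h z2 in
  let e := prox_residual gamma h z1 - prox_residual gamma h z2 in
  0 <= '[a *: (d + gamma *: e) - (d - gamma *: e),
         b *: (d + gamma *: e) + (d - gamma *: e)] ->
  `|reflected_prox gamma h z1 - reflected_prox gamma h z2|
    <= Num.max a b * `|z1 - z2|.
Proof.
move=> g0 ab d e.
have ge : gamma *: e = (z1 - z2) - d.
  rewrite /e /prox_residual -scalerBr scalerA divff ?gt_eqF// scale1r /d.
  by rewrite !opprB addrACA [RHS]addrACA [- z2 + _]addrC.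
have -> : d + gamma *: e = z1 - z2 by rewrite ge subrKC.
have -> : d - gamma *: e =
    reflected_prox gamma h z1 - reflected_prox gamma h z2.
  transitivity (2 *: d - (z1 - z2)).
    by rewrite ge opprB addrA -mulr2n -scaler_nat.
  by rewrite /reflected_prox /d scalerBr !opprB ![z2 - _]addrC addrACA.
exact: reflection_le.
Qed.

(** Adding the two subgradient inequalities gives monotonicity
    [0 <= '[e, d]], which is the condition of [reflected_prox_lipschitz] with
    [a = b = 1]. *)
Lemma reflected_prox_nonexpansive gamma h z1 z2 : 0 < gamma ->
  proper_function h -> closed_function h -> convex_efunction h ->
  `|reflected_prox gamma h z1 - reflected_prox gamma h z2| <= `|z1 - z2|.
Proof.
move=> g0 hp hcl hc.
have hs := convex_strongly_convex0 hc.
have [a1 h1 lo1] := prox_variational z1 g0 hp hcl hc hs.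
have [a2 h2 lo2] := prox_variational z2 g0 hp hcl hc hs.
have := lo1 _ _ h2; have := lo2 _ _ h1; rewrite !mul0r !addr0 => le2 le1.
have := @reflected_prox_lipschitz 1 1 gamma h z1 z2 g0.
rewrite maxxx mul1r; apply; first by lra.
move: le1 le2; set u1 := prox_residual _ _ z1; set u2 := prox_residual _ _ z2.
set p1 := prox _ _ z1; set p2 := prox _ _ z2 => le1 le2; clearbody u1 u2 p1 p2.
have mono : 0 <= '[u1 - u2, p1 - p2].
  move: le1 le2; rewrite !ipE; lra.
move: (p1 - p2) (u1 - u2) mono => d e mono.
rewrite !scale1r.
have -> : '[d + gamma *: e - (d - gamma *: e),
            d + gamma *: e + (d - gamma *: e)]
    = 4 * gamma * '[e, d].
  by rewrite !ipE (ipC d e); ring.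
by rewrite !mulr_ge0// ltW.
Qed.

(** The inequality of [interpolation_ge0] is, up to a positive factor, the
    condition of [reflected_prox_lipschitz] for the two quotients. *)
Lemma reflected_prox_contraction sigma beta gamma h z1 z2 :
  0 < sigma -> sigma <= beta -> 0 < gamma ->
  proper_function h -> closed_function h -> convex_efunction h ->
  strongly_convex sigma h -> smooth beta h ->
  `|reflected_prox gamma h z1 - reflected_prox gamma h z2| <=
  Num.max ((gamma * beta - 1) / (gamma * beta + 1))
          ((1 - gamma * sigma) / (1 + gamma * sigma)) * `|z1 - z2|.
Proof.
move=> s0 sb g0 hp hcl hc hs hsm.
have gs0 : 0 < gamma * sigma by rewrite mulr_gt0.
have gsb : gamma * sigma <= gamma * beta by rewrite ler_pM2l.
have D1 : 0 < 1 + gamma * sigma by lra.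
have D2 : 0 < gamma * beta + 1 by lra.
have hE x : h x = (fine (h x))%:E by rewrite fineK// hsm.1.1.
have lo z w : fine (h (prox gamma h z)) +
    '[prox_residual gamma h z, w - prox gamma h z] +
    sigma / 2 * `|w - prox gamma h z| ^+ 2 <= fine (h w).
  have [a ha lo] := prox_variational z g0 hp hcl hc hs.
  by rewrite ha; apply: lo; exact: hE.
have up z w : fine (h w) <= fine (h (prox gamma h z)) +
    '[prox_residual gamma h z, w - prox gamma h z] +
    beta / 2 * `|w - prox gamma h z| ^+ 2.
  apply: (smooth_upper_bound hsm (hE _) _ (hE w)) => v b hv.
  have := lo z v; rewrite hv /=; apply: le_trans.
  by rewrite lerDl mulr_ge0 ?exprn_ge0// divr_ge0// ltW.
have := interpolation_ge0 sb (lo z1) (lo z2) (up z1) (up z2).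
rewrite maxC => inter; apply: reflected_prox_lipschitz => //.
  have -> : (1 - gamma * sigma) / (1 + gamma * sigma) +
      (gamma * beta - 1) / (gamma * beta + 1) =
      2 * (gamma * beta - gamma * sigma) /
      ((1 + gamma * sigma) * (gamma * beta + 1)).
    by field; rewrite !gt_eqF.
  by rewrite divr_ge0 ?mulr_ge0 ?subr_ge0// ltW.
move: inter => /=; move: (prox gamma h z1 - prox gamma h z2)
  (prox_residual gamma h z1 - prox_residual gamma h z2) => d e inter.
have -> : '[((1 - gamma * sigma) / (1 + gamma * sigma)) *: (d + gamma *: e) -
    (d - gamma *: e), ((gamma * beta - 1) / (gamma * beta + 1)) *:
    (d + gamma *: e) + (d - gamma *: e)] =
  4 * gamma ^+ 2 / ((1 + gamma * sigma) * (gamma * beta + 1)) *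
    '[e - sigma *: d, beta *: d - e].
  by rewrite !ipE (ipC d e); field; rewrite !gt_eqF.
by rewrite mulr_ge0// divr_ge0 ?mulr_ge0 ?sqr_ge0// ltW.
Qed.

End HilbertSpace.

(* H is a real Hilbert space: complete, with norm induced by the inner
   product ip. *)
Theorem theorem2 (R : realType) (H : completeNormedModType R)
  (ip : {dot H for idfun}) (normH : forall x : H, `|x| ^+ 2 = ip x x)
  (sigma beta : R) (sigma_gt0 : 0 < sigma) (sigma_le_beta : sigma <= beta)
  (f g : H -> \bar R)
  (f_proper : proper_function f) (f_closed : closed_function f)
  (f_convex : convex_efunction f)
  (g_proper : proper_function g) (g_closed : closed_function g)
  (g_convex : convex_efunction g)
  (f_strong : strongly_convex sigma f) (f_smooth : smooth beta f)
  (gamma : R) (gamma_gt0 : 0 < gamma) (delta : R)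
  (deltaE : delta = Num.max ((gamma * beta - 1) / (gamma * beta + 1))
                            ((1 - gamma * sigma) / (1 + gamma * sigma)))
  (alpha : R) (alpha_gt0 : 0 < alpha) (alpha_lt : alpha < 2 / (1 + delta))
  (z : nat -> H)
  (z_DR : forall k : nat, z k.+1 = (1 - alpha) *: z k +
     alpha *: reflected_prox gamma g (reflected_prox gamma f (z k))) :
  `|1 - alpha| + alpha * delta < 1 /\
  exists zbar : H,
    reflected_prox gamma g (reflected_prox gamma f zbar) = zbar /\
    forall k : nat,
      `|z k.+1 - zbar| <= (`|1 - alpha| + alpha * delta) * `|z k - zbar|.
Proof.
pose T x := reflected_prox gamma g (reflected_prox gamma f x).
have T_lip x y : `|T x - T y| <= delta * `|x - y|.
  apply: (le_trans (reflected_prox_nonexpansive normH _ _ gamma_gt0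
    g_proper g_closed g_convex)).
  by rewrite deltaE; exact: (reflected_prox_contraction normH).
have gs_gt0 : 0 < gamma * sigma by rewrite mulr_gt0.
have gsb : gamma * sigma <= gamma * beta by rewrite ler_pM2l.
have delta_lt1 : delta < 1.
  by rewrite deltaE gt_max !ltr_pdivrMr ?mul1r; lra.
(* The quotients cannot both be negative, as gamma * sigma <= gamma * beta. *)
have delta_ge0 : 0 <= delta.
  rewrite deltaE le_max; have [gb1|gb1] := leP 1 (gamma * beta).
    by rewrite divr_ge0//; lra.
  by rewrite [X in _ || X]divr_ge0 ?orbT//; lra.
have rate_lt1 : `|1 - alpha| + alpha * delta < 1.
  have : alpha * delta < alpha by rewrite gtr_pMr.
  have : alpha * (1 + delta) < 2 by rewrite -ltr_pdivlMr//; lra.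
  have [a1|a1] := ger0P (1 - alpha); lra.
split=> //.
have T_contr : is_contraction (totalfun T : {fun setT >-> setT}).
  exists (NngNum delta_ge0); split => //= -[x y] _ /=; exact: T_lip.
have [zbar _ zbarE] := banach_fixed_point T_contr closedT (ex_intro _ 0 I).
exists zbar; split=> [|k]; first exact/esym.
have -> : z k.+1 - zbar =
    (1 - alpha) *: (z k - zbar) + alpha *: (T (z k) - T zbar).
  rewrite z_DR -/(T _).
  have {1}-> : zbar = (1 - alpha) *: zbar + alpha *: T zbar.
    by rewrite -[T zbar]zbarE -scalerDl subrK scale1r.
  by move: (T zbar) (T (z k)) => Tzbar Tzk; rewrite !scalerBr opprD addrACA.
apply: (le_trans (ler_normD _ _)); rewrite !normrZ (gtr0_norm alpha_gt0).
by rewrite [leRHS]mulrDl -mulrA lerD2l ler_pM2l.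
Qed.
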